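(* For every integer $n\ge 1$, the number of integer partitions of $n$ into at least two distinct parts equals $|L_2(n)|$.
   Context: Fix a field $K$. For a polynomial ring $R=K[x_1,\dots,x_m]$ with standard grading and a homogeneous ideal $I$ with $R/I$ of Krull dimension zero, the $h$-vector of $R/I$ is $(H(0),H(1),\dots,H(s))$ where $H(t)=\dim_K(R/I)_t$ and $s$ is the largest index with $H(s)\ne0$. An $h$-vector is any vector arising this way. $L_2(n)$ is the set of $h$-vectors $(1,h_1,\dots,h_s)$ whose entries sum to $n$ and with $h_1=2$. *)

(* Defs.v *)
From HB Require Import structures.
From mathcomp Require Import all_boot all_order all_algebra.
From mathcomp Require Import classical_sets functions cardinality.
From mathcomp Require Import mpoly.

Set Implicit Arguments.
Unset Strict Implicit.
Unset Printing Implicit Defensive.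

Import GRing.Theory.
Local Open Scope ring_scope.
Local Open Scope quotient_scope.
Local Open Scope classical_set_scope.

(* [idealr] and [prime_idealr] are the library's proper, resp. prime, ideals.
   Their membership predicates are boolean, which is no restriction under the
   classical axioms of [boolp]. *)

Definition strict_prime_chain (A : comNzRingType) (l : nat)
    (P : 'I_l.+1 -> prime_idealr A) : Prop :=
  forall i j : 'I_l.+1, (i < j)%N ->
    {subset P i <= P j} /\ exists2 x : A, x \in P j & x \notin P i.

Definition krull_dim_eq (A : comNzRingType) (d : nat) : Prop :=
  (exists P : 'I_d.+1 -> prime_idealr A, strict_prime_chain P) /\
  (forall (l : nat) (P : 'I_l.+1 -> prime_idealr A),
     strict_prime_chain P -> (l <= d)%N).

Section GradedQuotient.

Context {K : fieldType} {m : nat}.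
Implicit Type I : idealr {mpoly K[m]}.

Definition homogeneous_ideal I : Prop :=
  forall p : {mpoly K[m]}, p \in I -> forall d : nat, pihomog mdeg d p \in I.

Definition quot_scale I (c : K) (x : {ideal_quot I}) : {ideal_quot I} :=
  \pi_{ideal_quot I} c%:MP_[m] * x.

(* (R/I)_t, the image of R_t in R/I *)
Definition graded_piece I (t : nat) : set {ideal_quot I} :=
  [set x | exists2 p : {mpoly K[m]}, p \is t.-homog & x = \pi p].
Arguments graded_piece I t _ : clear implicits.

Definition graded_basis I (t h : nat) (b : 'I_h -> {ideal_quot I}) : Prop :=
  (forall i, graded_piece I t (b i)) /\
  (forall x, graded_piece I t x ->
     exists! c : {ffun 'I_h -> K}, x = \sum_(i < h) quot_scale (c i) (b i)).

(* H(t) = h, that is, dim_K (R/I)_t = h *)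
Definition hilbert_eq I (t h : nat) : Prop :=
  exists b : 'I_h -> {ideal_quot I}, graded_basis t b.

(* Since [nth 0 v t] is 0 beyond the end of [v], the last two conditions say
   that v = (H(0), ..., H(s)) with s the largest index such that H(s) != 0. *)
Definition h_vector_of I (v : seq nat) : Prop :=
  (forall t : nat, hilbert_eq I t (nth 0%N v t)) /\ last 0%N v != 0%N.

End GradedQuotient.

Definition is_h_vector (K : fieldType) (v : seq nat) : Prop :=
  exists (m : nat) (I : idealr {mpoly K[m]}),
    [/\ homogeneous_ideal I, krull_dim_eq {ideal_quot I} 0 & h_vector_of I v].

Definition L2 (K : fieldType) (n : nat) : set (seq nat) :=
  [set v | [/\ is_h_vector K v, nth 0%N v 0 = 1%N, nth 0%N v 1 = 2%N
             & sumn v = n]].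

Definition is_partition (n : nat) (s : seq nat) : Prop :=
  [/\ sorted geq s, 0%N \notin s & sumn s = n].

Definition distinct_partitions_ge2 (n : nat) : set (seq nat) :=
  [set s | [/\ is_partition n s, uniq s & (2 <= size s)%N]].

(* Main.v *)
(* A partition with strictly decreasing parts [s_0 > ... > s_(d-1) > 0] is drawn
   with [s_b] cells in row [b]. Counting cells along antidiagonals gives the
   Hilbert function [h] of the quotient of [K[x, y]] by the monomials outside the
   diagram, and distinctness of the parts makes [b < h t] equivalent to
   [b <= t < s_b + b]; hence [s_b] is the number of [t] with [b < h t] and [h]
   determines the partition. Conversely, Macaulay's bound in two variables,
   [h t <= t + 1] and [h (t + 1) <= h t] as soon as [h t <= t], says exactly that
   [t | b < h t] is an interval starting at [b]. The bound itself holds because the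
   relations [V] among the monomials of degree [t] in a basis [u, v] of the degree
   one part, dehomogenized, satisfy [dim (V + 'X * V) > dim V] unless [V = 0]. *)
From HB Require Import structures.
Require Import Defs.
From mathcomp Require Import all_boot all_order all_algebra.
From mathcomp Require Import classical_sets functions cardinality.
From mathcomp Require Import mpoly zify ring.

Set Implicit Arguments.
Unset Strict Implicit.
Unset Printing Implicit Defensive.

Import GRing.Theory.

(** * Antidiagonals of strict partitions *)

(** Being down-closed and empty from [n] on, [P] is an initial segment of the naturals, and the
    count is its length. *)
Lemma ltn_count_iota (P : pred nat) (n b : nat) :
    (forall i j, i <= j -> P j -> P i) -> (forall i, n <= i -> ~~ P i) ->
  (b < count P (iota 0 n)) = P b.
Proof.
move=> dcP P0; have leC k : count P (iota 0 k) <= k.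
  by rewrite -[leqRHS](size_iota 0) count_size.
have ltC k : b < k -> (b < count P (iota 0 k)) = P b.
  elim: k => // k IHk; rewrite ltnS => le_bk.
  rewrite -[X in iota 0 X]addn1 iotaD count_cat /= addn0; have [Pk|nPk] := boolP (P k).
    have /eqP-> : count P (iota 0 k) == size (iota 0 k).
      by rewrite -all_count; apply/allP => i; rewrite mem_iota => /andP[_ /ltnW/dcP]; apply.
    by rewrite size_iota addn1 ltnS le_bk (dcP _ _ le_bk).
  rewrite addn0; move: le_bk; rewrite leq_eqVlt => /predU1P[->|/IHk //].
  by rewrite (negPf nPk) ltnNge leC.
have [/ltC //|le_nb] := ltnP b n.
by rewrite (negPf (P0 _ le_nb)) ltnNge (leq_trans (leC n)).
Qed.

Lemma count_iota_interval (b k n : nat) :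
  k + b <= n -> count (fun t => b <= t < k + b) (iota 0 n) = k.
Proof.
move=> le_n; have -> : n = b + (k + (n - (k + b))) by lia.
rewrite iotaD count_cat iotaD count_cat add0n.
rewrite (@eq_in_count _ _ pred0) ?count_pred0; last first.
  by move=> i; rewrite mem_iota /=; lia.
rewrite (@eq_in_count _ _ predT) ?count_predT; last first.
  by move=> i; rewrite mem_iota /=; lia.
rewrite (@eq_in_count _ _ pred0) ?count_pred0 ?size_iota; last first.
  by move=> i; rewrite mem_iota /=; lia.
lia.
Qed.

Lemma count_nth_iota (T : Type) (x0 : T) (P : pred T) (s : seq T) :
  count P s = count (fun i => P (nth x0 s i)) (iota 0 (size s)).
Proof. by rewrite -[in LHS](mkseq_nth x0 s) /mkseq count_map. Qed.

(* The number of cells in the [t]-th antidiagonal of the diagram whose [b]-th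
   row has length [nth 0 s b]. *)
Definition diag_count (s : seq nat) (t : nat) : nat :=
  count (fun b => b <= t < nth 0 s b + b) (iota 0 (size s)).

Definition diag_vector (s : seq nat) : seq nat := mkseq (diag_count s) (head 0 s).

Section DiagVector.

Variable s : seq nat.
Hypotheses (s_sorted : sorted geq s) (s_uniq : uniq s).

(** Row [b] occupies the antidiagonals from [b] up to [nth 0 s b + b] excluded. Distinct parts drop
    by at least one per row, which offsets the shift of the starting point. *)
Lemma leq_nth_addn (b c : nat) :
  b <= c -> c < size s -> nth 0 s c + c <= nth 0 s b + b.
Proof.
elim: c => [|c IHc]; first by rewrite leqn0 => /eqP->.
rewrite leq_eqVlt => /predU1P[->//|]; rewrite ltnS => le_bc ltc.
apply: leq_trans (IHc le_bc (ltnW ltc)).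
have gec : nth 0 s c >= nth 0 s c.+1.
  by move/sortedP: s_sorted => /(_ 0 c ltc).
have nec : nth 0 s c != nth 0 s c.+1.
  by rewrite nth_uniq ?(ltnW ltc) // neq_ltn ltnSn.
lia.
Qed.

(** By [leq_nth_addn], the rows that meet antidiagonal [t] form an initial segment. *)
Lemma ltn_diag_count (b t : nat) :
  (b < diag_count s t) = (b <= t < nth 0 s b + b).
Proof.
apply: (@ltn_count_iota (fun b => b <= t < nth 0 s b + b)) => [i j le_ij|i le_i].
  have [lt_j|le_j] := ltnP j (size s); last by rewrite (nth_default _ le_j); lia.
  by have := leq_nth_addn le_ij lt_j; lia.
by rewrite nth_default //; lia.
Qed.

Lemma nth_diag_vector (t : nat) : nth 0 (diag_vector s) t = diag_count s t.
Proof.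
have [lt_t|le_t] := ltnP t (head 0 s); first by rewrite nth_mkseq.
rewrite nth_default ?size_mkseq //; apply/esym/eqP.
by rewrite -leqn0 leqNgt ltn_diag_count nth0; lia.
Qed.

Lemma diag_count_gt0 (t : nat) : (0 < diag_count s t) = (t < head 0 s).
Proof. by rewrite ltn_diag_count nth0; lia. Qed.

Lemma diag_vector_head : 0 < head 0 s -> nth 0 (diag_vector s) 0 = 1.
Proof.
rewrite -diag_count_gt0 nth_diag_vector.
by have := ltn_diag_count 1 0; lia.
Qed.

Lemma last_diag_vector : 0 < head 0 s -> last 0 (diag_vector s) != 0.
Proof.
move=> s0; rewrite -nth_last size_mkseq nth_diag_vector -lt0n diag_count_gt0.
by rewrite prednK.
Qed.

Lemma sumn_diag_vector : sumn (diag_vector s) = sumn s.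
Proof.
rewrite /diag_vector /diag_count sumnE big_map.
under eq_bigr do rewrite -sum1_count big_mkcond /=.
rewrite exchange_big /= -[in RHS](mkseq_nth 0 s) sumnE /mkseq big_map.
rewrite big_seq [RHS]big_seq; apply: eq_bigr => b; rewrite mem_iota => ltb.
rewrite -big_mkcond sum1_count count_iota_interval //.
(* Every row ends before antidiagonal [head 0 s], so the truncation loses no cell. *)
by have := leq_nth_addn (leq0n b) ltb; rewrite nth0; lia.
Qed.

End DiagVector.

Lemma diag_vector_inj (r s : seq nat) :
    sorted geq r -> uniq r -> 0 \notin r -> sorted geq s -> uniq s -> 0 \notin s ->
  diag_vector r = diag_vector s -> r = s.
Proof.
move=> sor ur r0 sos us s0 eq_rs.
have eq_nth b : nth 0 r b = nth 0 s b.
  have H t : (b <= t < nth 0 r b + b) = (b <= t < nth 0 s b + b).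
    by rewrite -!ltn_diag_count // -!nth_diag_vector // eq_rs.
  (* The excluded end of either interval, used as [t], shows that the other interval is not
     longer. *)
  by have := H (nth 0 r b + b); have := H (nth 0 s b + b); lia.
(* Reading entries with default [0] cannot detect trailing zeros; the absence of zero parts settles
   the sizes. *)
have size_le (u v : seq nat) : nth 0 u =1 nth 0 v -> 0 \notin v -> size v <= size u.
  move=> uv v0; rewrite leqNgt; apply: contra v0 => lt_uv.
  by rewrite -(nth_default 0 (leqnn (size u))) uv mem_nth.
apply: (@eq_from_nth _ 0) => [|i _]; last exact: eq_nth.
by apply/eqP; rewrite eqn_leq !size_le.
Qed.

(** * Strict partitions from sequences with Macaulay growth *)

Section ColumnCounts.

Variable v : seq nat.
Let h := nth 0 v.
Hypothesis h_le : forall t, h t <= t.+1.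
Hypothesis h_nincr : forall t, h t <= t -> h t.+1 <= h t.
Hypothesis v_last : last 0 v != 0.

(** The conjugate partition of the multiset of entries of [v]. *)
Let col b := count (fun x => b < x) v.

(** By [h_le], [b < h t] forces [b <= t]; by [h_nincr], once [h] is at most [b] at an index at least
    [b], it stays so. The level set is thus an interval starting at [b]. *)
Lemma ltn_nth_col (b t : nat) : (b < h t) = (b <= t < col b + b).
Proof.
have hS i : b <= i -> h i <= b -> h i.+1 <= b.
  by move=> le_bi le_h; have := h_nincr (leq_trans le_h le_bi); lia.
have hD i k : b <= i -> h i <= b -> h (i + k) <= b.
  move=> bi hi; elim: k => [|k IHk]; rewrite ?addn0 // addnS.
  by apply: hS => //; lia.
(* Shifting indices by [b] turns the interval into an initial segment: indices below [b] fail the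
   test, and the [b] extra ones past the end of [v] read the default [0]. *)
have colE : col b = count (fun j => b < h (b + j)) (iota 0 (size v)).
  rewrite /col (count_nth_iota 0) -/h.
  have -> : count (fun i => b < h i) (iota 0 (size v)) =
            count (fun i => b < h i) (iota 0 (size v + b)).
    rewrite iotaD count_cat [X in _ = _ + X](@eq_in_count _ _ pred0) ?count_pred0 ?addn0 //.
    by move=> i; rewrite mem_iota /h => /andP[le_i _] /=; rewrite nth_default //; lia.
  rewrite addnC iotaD count_cat (@eq_in_count _ _ pred0) ?count_pred0; last first.
    by move=> i; rewrite mem_iota /= => lt_i; have := h_le i; lia.
  by rewrite add0n -[X in iota X]addn0 iotaDl count_map.
have [le_bt|lt_tb] := leqP b t; last by have := h_le t; lia.
have -> : (t < col b + b) = (t - b < col b) by lia.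
rewrite colE (@ltn_count_iota (fun j => b < h (b + j))) ?subnKC //= => [i j le_ij|i le_i].
  by apply: contraLR; rewrite -!leqNgt => /(hD _ (j - i)); rewrite -addnA subnKC //; apply; lia.
by rewrite /h nth_default //; lia.
Qed.

Let s := mkseq col (\max_(x <- v) x).

Lemma nth_cols (b : nat) : nth 0 s b = col b.
Proof.
have [lt_b|le_b] := ltnP b (\max_(x <- v) x); first by rewrite nth_mkseq.
rewrite nth_default ?size_mkseq //; apply/esym/eqP; rewrite -leqn0 leqNgt -has_count.
apply/hasPn => x x_v; rewrite -leqNgt; apply: leq_trans le_b.
by rewrite (@leq_bigmax_seq _ _ _ id).
Qed.

Lemma col_gt0 (b : nat) : b < size s -> 0 < col b.
Proof.
rewrite size_mkseq -has_count; apply: contraLR => /hasPn nb; rewrite -leqNgt.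
by apply/bigmax_leqP_seq => x xv _; rewrite leqNgt nb.
Qed.

(** The last [t] with [b.+1 < h t] is [col b.+1 + b]; it also satisfies [b < h t], so it lies below
    [col b + b]. *)
Lemma col_decr (b : nat) : b.+1 < size s -> col b.+1 < col b.
Proof.
move/col_gt0 => gt0; have := ltn_nth_col b.+1 (col b.+1 + b).
by have := ltn_nth_col b (col b.+1 + b); lia.
Qed.

Lemma cols_sorted : sorted gtn s.
Proof.
by apply/(sortedP 0) => i lti; rewrite !nth_cols; apply: col_decr.
Qed.

Lemma cols_notin0 : 0 \notin s.
Proof.
apply/negP => /(nthP 0)[i lti]; rewrite nth_cols => c0.
by have := col_gt0 lti; rewrite c0.
Qed.

Lemma sumn_cols : sumn s = sumn v.
Proof.
rewrite /s !sumnE /mkseq big_map /col.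
under eq_bigr do rewrite -sum1_count big_mkcond /=.
rewrite exchange_big /= big_seq [RHS]big_seq; apply: eq_bigr => x xv.
rewrite -big_mkcond sum1_count; have := @count_iota_interval 0 x (\max_(y <- v) y).
by rewrite addn0; apply; rewrite (@leq_bigmax_seq _ _ _ id).
Qed.

Lemma diag_vector_cols : diag_vector s = v.
Proof.
have sos : sorted geq s by apply: sub_sorted cols_sorted => i j /ltnW.
have us : uniq s.
  by apply: sorted_uniq cols_sorted => [i j k /= ? ?|i]; [lia|rewrite /= ltnn].
(* The nonzero last entry puts the last index in the level set of [0], an interval starting at [0];
   so [v] has no zero entry. *)
have head_s : head 0 s = size v.
  rewrite -nth0 nth_cols; apply/eqP; rewrite eqn_leq count_size /=.
  have := ltn_nth_col 0 (size v).-1; rewrite /h nth_last lt0n v_last; lia.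
apply: (@eq_from_nth _ 0); rewrite size_mkseq // => t _.
rewrite nth_diag_vector //.
have H b : (b < diag_count s t) = (b < h t).
  by rewrite ltn_diag_count // nth_cols ltn_nth_col.
by have := H (h t); have := H (diag_count s t); rewrite /h; lia.
Qed.

Lemma size_cols (k t : nat) : h t = k -> k <= size s.
Proof.
rewrite size_mkseq => <-; have [lt_t|le_t] := ltnP t (size v).
  by rewrite (@leq_bigmax_seq _ _ _ id) // mem_nth.
by rewrite /h nth_default.
Qed.

End ColumnCounts.

(** A strict partition of [n] is determined by its set of parts, a subset of ['I_n.+1]. *)
Lemma finite_distinct_partitions_ge2 (n : nat) :
  finite_set (distinct_partitions_ge2 n).
Proof.
pose f (s : seq nat) := [set i : 'I_n.+1 | val i \in s].
have f_inj : {in distinct_partitions_ge2 n &, injective f}.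
  move=> r s; rewrite !inE => -[[sr r0 nr] ur _] [[ss s0 ns] us _] eq_f.
  have le_sumn u x : x \in u -> x <= sumn u.
    elim: u => //= y u IHu; rewrite inE => /predU1P[->|/IHu]; lia.
  apply: (@sorted_eq _ geq) => //; [by move=> ? ? ? /= ? ?; lia|by move=> ? ? /=; lia|].
  apply: uniq_perm => // x.
  have [lt_x|le_x] := ltnP x n.+1.
    have /setP/(_ (Ordinal lt_x)) := eq_f.
    by rewrite !inE.
  by apply/idP/idP => /le_sumn; lia.
have := @finite_finset _ (f @` distinct_partitions_ge2 n)%classic.
by rewrite (eq_finite_set (inj_card_eq f_inj)).
Qed.

Local Open Scope ring_scope.
Local Open Scope quotient_scope.

(** * Monomial ideals *)

Lemma pi_eq0 (R : comNzRingType) (I : idealr R) (p : R) :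
  (\pi_{ideal_quot I} p == 0) = (p \in I).
Proof. by rewrite -(subr0 p) Quotient.idealrBE subr0 -(rmorph0 (\pi_{ideal_quot I})). Qed.

Section MonomialIdeal.

Variables (K : fieldType) (m : nat).

(* [S] is meant to be the order ideal of the monomials outside the ideal. *)
Definition avoids (S : pred 'X_{1..m}) (p : {mpoly K[m]}) : bool :=
  all (predC S) (msupp p).

Variable S : pred 'X_{1..m}.
Hypothesis S0 : S 0%MM.
Hypothesis S_down : forall a b : 'X_{1..m}, S (a + b)%MM -> S a.

Lemma avoidsP (p : {mpoly K[m]}) :
  reflect (forall a, S a -> p@_a = 0) (avoids S p).
Proof.
apply: (iffP allP) => [Jp a Sa|Jp a].
  by apply/eqP; rewrite mcoeff_eq0; apply/negP => /Jp /=; rewrite Sa.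
by rewrite mcoeff_msupp; apply: contra => /Jp->.
Qed.

(** A coefficient of a product at a monomial of [S] only involves its divisors, which are again in
    [S]. *)
Lemma avoids_idealr_closed : idealr_closed (avoids S).
Proof.
split=> [||p u v /avoidsP Ju /avoidsP Jv].
- by apply/avoidsP => a _; rewrite mcoeff0.
- by apply/negP => /avoidsP/(_ _ S0)/eqP; rewrite mcoeff1 eqxx oner_eq0.
apply/avoidsP => a Sa; rewrite mcoeffD Jv // addr0 mcoeffM.
apply: big1 => -[b c] /= /eqP eq_a; rewrite Ju ?mulr0 //.
by apply: (@S_down _ b); rewrite addmC -eq_a.
Qed.

HB.instance Definition _ :=
  isIdealr.Build {mpoly K[m]} (avoids S) avoids_idealr_closed.

Definition monomial_ideal : idealr {mpoly K[m]} := avoids S.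

Local Notation J := monomial_ideal.
Local Notation A := {ideal_quot J}.

Lemma monomial_idealP (p : {mpoly K[m]}) :
  reflect (forall a, S a -> p@_a = 0) (p \in J).
Proof. exact: avoidsP. Qed.

Lemma homogeneous_monomial_ideal : homogeneous_ideal J.
Proof.
move=> p /monomial_idealP Jp d; apply/monomial_idealP => a Sa.
rewrite pihomogE raddf_sum big1 // => b _ /=; rewrite mcoeffZ mcoeffX.
by have [->|_] := eqVneq b a; rewrite ?mulr0 // Jp ?mul0r.
Qed.

(** The augmentation of the quotient. The choice of representative is harmless, since [S0] makes
    constant coefficients vanish on the ideal. *)
Definition const_coef (x : A) : K := (repr x)@_0%MM.

Lemma const_coef_pi (p : {mpoly K[m]}) : const_coef (\pi p) = p@_0%MM.
Proof.
have : repr (\pi_A p) - p \in J by rewrite Quotient.idealrBE reprK eqxx.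
by move/monomial_idealP/(_ _ S0)/eqP; rewrite mcoeffB subr_eq0 => /eqP.
Qed.

Lemma const_coef_is_zmod_morphism : zmod_morphism const_coef.
Proof.
move=> x y; rewrite -[x]reprK -[y]reprK -rmorphB !const_coef_pi.
exact: mcoeffB.
Qed.

Lemma const_coef_is_monoid_morphism : monoid_morphism const_coef.
Proof.
split=> [|x y]; first by rewrite -(rmorph1 \pi_A) const_coef_pi mcoeff1 eqxx.
by rewrite -[x]reprK -[y]reprK -rmorphM !const_coef_pi rmorphM.
Qed.

HB.instance Definition _ :=
  GRing.isZmodMorphism.Build A K const_coef const_coef_is_zmod_morphism.
HB.instance Definition _ :=
  GRing.isMonoidMorphism.Build A K const_coef const_coef_is_monoid_morphism.

Definition no_const_coef : pred A := fun x => const_coef x == 0.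

Lemma no_const_coef_idealr_closed : idealr_closed no_const_coef.
Proof.
rewrite /no_const_coef; split=> [||a u v]; rewrite unfold_in.
- by rewrite rmorph0.
- by rewrite rmorph1 oner_eq0.
by move=> /eqP u0 /eqP v0; rewrite unfold_in rmorphD rmorphM /= u0 v0 mulr0 addr0.
Qed.

Lemma no_const_coef_prime : prime_idealr_closed no_const_coef.
Proof. by move=> u v; rewrite !unfold_in /no_const_coef rmorphM mulf_eq0. Qed.

HB.instance Definition _ :=
  isIdealr.Build A no_const_coef no_const_coef_idealr_closed.
HB.instance Definition _ :=
  isPrimeIdealrClosed.Build A no_const_coef no_const_coef_prime.

Definition irrelevant_ideal : prime_idealr A := no_const_coef.

Section KrullDim.

Variable D : nat.
Hypothesis S_bounded : forall a, S a -> (mdeg a < D)%N.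

(** The [D]-th power of a nonconstant monomial has degree at least [D], hence is in the ideal: such
    monomials are nilpotent in the quotient and lie in every prime. *)
Lemma const_coef_eq0_mem_prime (P : prime_idealr A) (x : A) :
  const_coef x = 0 -> x \in P.
Proof.
rewrite -[x]reprK const_coef_pi => x0; rewrite [repr x]mpolyE rmorph_sum.
rewrite big_seq; apply: rpred_sum => a; rewrite mcoeff_msupp => xa.
rewrite -mul_mpolyC rmorphM prime_idealrM; apply/orP; right.
have a0 : (0 < mdeg a)%N.
  by rewrite lt0n mdeg_eq0; apply: contra xa => /eqP->; rewrite x0.
have : \pi_A 'X_[a] ^+ D \in P.
  suff -> : \pi_A 'X_[a] ^+ D = 0 by exact: idealr0.
  apply/eqP; rewrite -rmorphXn mpolyXn pi_eq0; apply/monomial_idealP => b /S_bounded lt_b; rewrite mcoeffX.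
  case: eqP lt_b => // <-; rewrite mdegMn; nia.
elim: D => [|k IHk]; first by rewrite expr0 idealr1.
by rewrite exprS prime_idealrM => /orP[|/IHk].
Qed.

(** Otherwise [P] would contain the constant coefficient of [x], a unit, because the difference is
    in [P] by [const_coef_eq0_mem_prime]. *)
Lemma mem_prime_const_coef (P : prime_idealr A) (x : A) :
  x \in P -> const_coef x = 0.
Proof.
move=> Px; apply/eqP; apply: contraFT (idealr1 P) => c0.
pose y : A := \pi_A (const_coef x)%:MP_[m].
have Py : y \in P.
  rewrite -[y](subKr x) rpredB // const_coef_eq0_mem_prime // rmorphB.
  by rewrite /= const_coef_pi mcoeffC eqxx mulr1 subrr.
have -> : 1 = \pi_A (const_coef x)^-1%:MP_[m] * y.
  by rewrite -rmorphM -mpolyCM mulVf // rmorph1.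
by rewrite prime_idealrM Py orbT.
Qed.

(** Every prime equals the irrelevant ideal, so a strict chain has a single member. *)
Lemma krull_dim_monomial_ideal : krull_dim_eq A 0.
Proof.
split=> [|l P chainP]; first by exists (fun=> irrelevant_ideal) => i j; rewrite !ord1.
rewrite leqNgt; apply/negP => l_gt0.
have [_ [x Px /negP[]]] := chainP ord0 (Ordinal (l_gt0 : 1 < l.+1)%N) isT.
exact/const_coef_eq0_mem_prime/(mem_prime_const_coef Px).
Qed.

End KrullDim.

(** The basis consists of the classes of the monomials of degree [t] in [S]. Two polynomials agree
    in the quotient exactly when their coefficients on [S] do. *)
Lemma hilbert_monomial_ideal (t h : nat) (e : 'I_h -> 'X_{1..m}) :
    injective e -> (forall i, mdeg (e i) = t) -> (forall i, S (e i)) ->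
    (forall a, S a -> mdeg a = t -> exists i, a = e i) ->
  hilbert_eq J t h.
Proof.
move=> e_inj e_deg S_e e_surj; exists (fun i => \pi 'X_[e i]); split=> [i|x].
  by exists 'X_[e i] => //; rewrite dhomogX /= e_deg.
case=> p p_hom ->.
have scaleE (c : {ffun 'I_h -> K}) :
    \sum_(i < h) quot_scale (c i) (\pi_A 'X_[e i]) =
    \pi_A (\sum_(i < h) c i *: 'X_[e i]).
  by rewrite rmorph_sum; apply: eq_bigr => i _; rewrite -mul_mpolyC rmorphM.
have coefE (c : {ffun 'I_h -> K}) (j : 'I_h) :
    (\sum_(i < h) c i *: 'X_[e i])@_(e j) = c j.
  rewrite raddf_sum (bigD1 j) //= mcoeffZ mcoeffX eqxx mulr1 big1 ?addr0 // => i ne_ij.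
  by rewrite mcoeffZ mcoeffX (inj_eq e_inj) (negPf ne_ij) mulr0.
exists [ffun i => p@_(e i)]; split=> [|c]; rewrite scaleE; last first.
  move/eqP; rewrite -Quotient.idealrBE => /monomial_idealP H; apply/ffunP => j; rewrite ffunE.
  by apply/eqP; rewrite -subr_eq0 -(coefE c j) -mcoeffB H.
apply/eqP; rewrite -Quotient.idealrBE; apply/monomial_idealP => a Sa.
rewrite mcoeffB; have [/(e_surj _ Sa)[j ->]|ne_t] := eqVneq (mdeg a) t.
  by rewrite coefE ffunE subrr.
rewrite (dhomog_nemf_coeff p_hom ne_t) raddf_sum big1 ?subrr // => i _ /=.
rewrite mcoeffZ mcoeffX; have [eq_a|_] := eqVneq (e i) a; last by rewrite mulr0.
by rewrite -eq_a e_deg eqxx in ne_t.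
Qed.

End MonomialIdeal.

(** * Monomial quotients in two variables attached to strict partitions *)

Section TwoVariables.

Variables (K : fieldType) (s : seq nat).
Hypotheses (s_sorted : sorted geq s) (s_uniq : uniq s).
Hypothesis s_head : (0 < head 0 s)%N.

Let cells (a : 'X_{1..2}) : bool := (a ord0 < nth 0 s (a ord_max))%N.

Definition antidiag_mnm (t i : nat) : 'X_{1..2} :=
  [multinom (if j == ord0 then (t - i)%N else i) | j < 2].

Lemma antidiag_mnm0 (t i : nat) : antidiag_mnm t i ord0 = (t - i)%N.
Proof. by rewrite mnmE eqxx. Qed.

Lemma antidiag_mnm1 (t i : nat) : antidiag_mnm t i ord_max = i.
Proof. by rewrite mnmE. Qed.

Lemma mdeg2 (a : 'X_{1..2}) : mdeg a = (a ord0 + a ord_max)%N.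
Proof. by rewrite mdegE big_ord_recl big_ord1; congr (_ + a _)%N; apply/val_inj. Qed.

Lemma mnm2_eq (a b : 'X_{1..2}) : a ord0 = b ord0 -> a ord_max = b ord_max -> a = b.
Proof.
move=> ab0 ab1; apply/mnmP => -[[|[|//]] lt_i].
  by rewrite (_ : Ordinal lt_i = ord0) //; apply/val_inj.
by rewrite (_ : Ordinal lt_i = ord_max) //; apply/val_inj.
Qed.

Lemma is_h_vector_diag_vector : is_h_vector K (diag_vector s).
Proof.
have cells0 : cells 0%MM by rewrite /cells !mnm0E nth0.
have cells_down (a b : 'X_{1..2}) : cells (a + b)%MM -> cells a.
  rewrite /cells !mnmDE => ltab; have lt_s : (a ord_max + b ord_max < size s)%N.
    by rewrite ltnNge; apply/negP => le_s; rewrite nth_default in ltab.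
  by have := leq_nth_addn s_sorted s_uniq (leq_addr (b ord_max) (a ord_max)) lt_s; lia.
(* The exponent of the second variable is the row, that of the first the column, and the degree is
   the index of the antidiagonal. *)
have cellsE (a : 'X_{1..2}) : cells a = (a ord_max < diag_count s (mdeg a))%N.
  by rewrite ltn_diag_count // mdeg2 /cells; lia.
exists 2%N, (monomial_ideal K cells0 cells_down); split.
- exact: homogeneous_monomial_ideal.
- apply: (@krull_dim_monomial_ideal _ _ _ _ _ (head 0 s)) => a.
  by rewrite cellsE -diag_count_gt0 //; apply: leq_ltn_trans.
split=> [t|]; last exact: last_diag_vector.
rewrite nth_diag_vector //.
have deg_e (i : nat) : (i < diag_count s t)%N -> mdeg (antidiag_mnm t i) = t.
  by rewrite mdeg2 antidiag_mnm0 antidiag_mnm1 ltn_diag_count //; lia.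
apply: (@hilbert_monomial_ideal _ _ _ _ _ _ _ (fun i => antidiag_mnm t i)).
- move=> i j /(congr1 (fun a : 'X_{1..2} => a ord_max)).
  by rewrite !antidiag_mnm1 => /val_inj.
- by move=> i; apply: deg_e.
- by move=> i; rewrite cellsE deg_e // antidiag_mnm1.
move=> a; rewrite cellsE => lt_a deg_a; rewrite deg_a in lt_a.
exists (Ordinal lt_a); apply: mnm2_eq; rewrite ?antidiag_mnm0 ?antidiag_mnm1 //=.
by rewrite -deg_a mdeg2 addnK.
Qed.

End TwoVariables.

(** * Growth of Hilbert functions with [h 1 = 2] *)

(* A nonzero space [V] of polynomials is not stable under multiplication by
   ['X], so that [V + 'X * V] is strictly larger than [V]. *)
Lemma mxrank_lt_mulX (K : fieldType) (k l n : nat)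
    (V : 'M[K]_(k, n)) (W : 'M[K]_(l, n.+1)) :
    V != 0 ->
    (forall r : 'rV_n, (r <= V)%MS ->
       (poly_rV (rVpoly r) <= W)%MS /\ (poly_rV ('X * rVpoly r) <= W)%MS) ->
  (\rank V < \rank W)%N.
Proof.
rewrite -mxrank_eq0 -lt0n => rk_gt0 VW; pose B := row_base V.
pose p (i : 'I_(\rank V)) := rVpoly (row i B).
(* A basis polynomial of maximal degree bounds the degree of all of [V], so its product with ['X]
   escapes [V]. *)
have [i0 _ maxp] := arg_maxnP (fun i => size (p i)) (erefl : predT (Ordinal rk_gt0)).
have size_p (r : 'rV_(\rank V)) : (size (rVpoly (r *m B)) <= size (p i0))%N.
  rewrite mulmx_sum_row linear_sum; apply: (leq_trans (size_sum _ _ _)).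
  apply/bigmax_leqP => i _; rewrite linearZ; apply: leq_trans (size_scale_leq _ _) _.
  exact: maxp.
have B_inj (r : 'rV_(\rank V)) : rVpoly (r *m B) = 0 -> r = 0.
  move=> /(congr1 (@poly_rV _ n)); rewrite rVpolyK linear0 => rB0.
  by apply: (row_free_inj (row_base_free V)); rewrite mul0mx.
have p0 : p i0 != 0.
  apply/eqP; rewrite /p rowE => /B_inj/eqP.
  by apply/negP; rewrite -mxrank_eq0 mxrank_delta.
have size_n (r : 'rV[K]_n) : (size (rVpoly r) <= n)%N by exact: size_poly.
pose C := \matrix_(i < \rank V) (poly_rV (p i) : 'rV_n.+1).
have CE (r : 'rV_(\rank V)) : r *m C = poly_rV (rVpoly (r *m B)).
  rewrite !mulmx_sum_row !linear_sum; apply: eq_bigr => i _.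
  by rewrite rowK !linearZ.
pose q : 'rV_n.+1 := poly_rV ('X * p i0).
have sizeX : size ('X * p i0) = (size (p i0)).+1 by rewrite mulrC size_mulX.
(* In a linear relation, a nonzero coefficient on [q] would equate, up to sign, a polynomial of [V]
   with one of larger degree; what remains is a relation within the basis [B]. *)
have free_Cq : row_free (col_mx C q).
  apply: inj_row_free => r; rewrite -[r]hsubmxK mul_row_col CE.
  rewrite [rsubmx r]mx11_scalar mul_scalar_mx -linearZ -linearD /=.
  move/(congr1 rVpoly); rewrite linear0 poly_rV_K; last first.
    rewrite (leq_trans (size_polyD _ _)) // geq_max (leq_trans (size_n _)) //=.
    by rewrite (leq_trans (size_scale_leq _ _)) // sizeX ltnS size_n.
  set c := rsubmx r 0 0 => eq0; have c0 : c = 0.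
    apply/eqP; apply: contraT => c_neq0; move/eqP: eq0.
    rewrite addr_eq0 => /eqP/(congr1 (size \o val)) /=.
    rewrite size_polyN size_scale // sizeX => eq_size.
    by have := size_p (lsubmx r); rewrite eq_size ltnn.
  move: eq0; rewrite c0 scale0r addr0 => /B_inj->.
  by rewrite raddf0 row_mx0.
suff sub : (col_mx C q <= W)%MS.
  by move/mxrankS: sub; rewrite (eqP free_Cq) addn1.
have subV i : (row i B <= V)%MS by rewrite (submx_trans (row_sub _ _)) // eq_row_base.
rewrite col_mx_sub; apply/andP; split; last by have [] := VW _ (subV i0).
by apply/row_subP => i; rewrite rowK; have [] := VW _ (subV i).
Qed.

Section Growth.

Variables (K : fieldType) (m : nat) (I : idealr {mpoly K[m]}).
Local Notation A := {ideal_quot I}.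
Local Notation scal c := (\pi_A c%:MP_[m]).

Section BinaryForms.

Variables u v : A.
Hypotheses (u_deg1 : graded_piece (I := I) 1 u) (v_deg1 : graded_piece (I := I) 1 v).
Hypothesis uv_span :
  forall x, graded_piece (I := I) 1 x -> exists a b : K, x = scal a * u + scal b * v.

(* The value at [(u, v)] of the binary form of degree [t] with dehomogenization [p]. *)
Definition form_eval (t : nat) (p : {poly K}) : A :=
  \sum_(i < t.+1) scal p`_i * (u ^+ i * v ^+ (t - i)).

Lemma form_evalD (t : nat) (p q : {poly K}) :
  form_eval t (p + q) = form_eval t p + form_eval t q.
Proof.
rewrite /form_eval -big_split; apply: eq_bigr => i _ /=.
by rewrite coefD mpolyCD rmorphD mulrDl.
Qed.

Lemma form_evalZ (t : nat) (c : K) (p : {poly K}) :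
  form_eval t (c *: p) = scal c * form_eval t p.
Proof.
rewrite /form_eval mulr_sumr; apply: eq_bigr => i _ /=.
by rewrite coefZ mpolyCM rmorphM -mulrA.
Qed.

Lemma form_eval_mulX (t : nat) (p : {poly K}) :
  form_eval t.+1 ('X * p) = u * form_eval t p.
Proof.
rewrite /form_eval big_ord_recl coefXM /= rmorph0 mul0r add0r mulr_sumr.
by apply: eq_bigr => i _; rewrite coefXM /= subSS exprS; ring.
Qed.

(** Dehomogenizing sets [v] to [1], so multiplying by [v] leaves the polynomial unchanged; the size
    bound excludes a term in [u ^+ t.+1]. *)
Lemma form_eval_widen (t : nat) (p : {poly K}) :
  (size p <= t.+1)%N -> form_eval t.+1 p = v * form_eval t p.
Proof.
move=> size_p; rewrite /form_eval big_ord_recr /= nth_default // rmorph0 mul0r addr0.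
rewrite mulr_sumr; apply: eq_bigr => i _ /=.
have le_it : (i <= t)%N by rewrite -ltnS.
by rewrite subSn // exprS; ring.
Qed.

(** Whatever the number of variables, the class of each is a combination of [u] and [v]; splitting
    one variable off a monomial gives an induction on the degree. *)
Lemma graded_piece_form_eval (t : nat) (x : A) :
  graded_piece (I := I) t x -> exists2 p : {poly K}, (size p <= t.+1)%N & x = form_eval t p.
Proof.
have mon a : mdeg a = t ->
    exists2 p : {poly K}, (size p <= t.+1)%N & \pi_A 'X_[a] = form_eval t p.
  elim: t a => [|t IHt] a deg_a.
    exists 1; first by rewrite size_poly1.
    move/eqP: deg_a; rewrite mdeg_eq0 => /eqP->; rewrite mpolyX0 /form_eval big_ord1.
    by rewrite coefC /= rmorph1 !expr0 !mulr1.
  have [i ai] : exists i, (0 < a i)%N.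
    apply/existsP; apply: contraPT deg_a => /existsPn a0; rewrite mdegE big1 // => i _.
    by apply/eqP; rewrite -leqn0 leqNgt a0.
  have le_a : (U_(i) <= a)%MM by rewrite lep1mP -lt0n.
  have deg_a' : mdeg (a - U_(i))%MM = t.
    by have := mdegD (a - U_(i))%MM U_(i)%MM; rewrite submK // deg_a mdeg1; lia.
  have [p size_p eq_p] := IHt _ deg_a'.
  have [|c [d eq_i]] := uv_span (x := \pi_A 'X_i).
    by exists 'X_i => //; rewrite dhomogX /= mdeg1.
  exists (c *: ('X * p) + d *: p).
    rewrite (leq_trans (size_polyD _ _)) // geq_max !(leq_trans (size_scale_leq _ _)) ?andbT //.
      exact: leq_trans size_p _.
    by rewrite (leq_trans (size_polyMleq _ _)) // size_polyX.
  rewrite form_evalD !form_evalZ form_eval_mulX form_eval_widen //.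
  by rewrite -(submK le_a) addmC mpolyXD rmorphM /= eq_i eq_p; ring.
case=> p p_hom ->; rewrite [p]mpolyE rmorph_sum big_seq.
apply: (big_ind (fun x => exists2 q : {poly K}, (size q <= t.+1)%N & x = form_eval t q)).
- exists 0; first by rewrite size_poly0.
  by rewrite -[0 in RHS](scale0r 0) form_evalZ rmorph0 mul0r.
- move=> _ _ [q1 s1 ->] [q2 s2 ->]; exists (q1 + q2); last by rewrite form_evalD.
  by rewrite (leq_trans (size_polyD _ _)) // geq_max s1.
move=> a /(dhomog_mf p_hom)/mon[q size_q eq_q]; exists (p@_a *: q).
  exact: leq_trans (size_scale_leq _ _) _.
by rewrite -mul_mpolyC rmorphM /= eq_q form_evalZ.
Qed.

(** Rank-nullity for the evaluation of binary forms of degree [t], with matrix [M] in a basis of the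
    graded piece. [M] has full column rank because evaluation is onto, by
    [graded_piece_form_eval]. *)
Lemma form_kernel (t h : nat) : hilbert_eq I t h ->
  exists V : 'M[K]_t.+1, (\rank V + h = t.+1)%N /\
    forall r : 'rV_t.+1, (r <= V)%MS <-> form_eval t (rVpoly r) = 0.
Proof.
move=> [b [b_t b_basis]].
have mon_t (i : 'I_t.+1) : graded_piece (I := I) t (u ^+ i * v ^+ (t - i)).
  have [pu pu_hom ->] := u_deg1; have [pv pv_hom ->] := v_deg1.
  exists (pu ^+ i * pv ^+ (t - i)); last by rewrite rmorphM !rmorphXn.
  have := dhomogM (dhomogMn i pu_hom) (dhomogMn (t - i) pv_hom).
  by rewrite !mul1n subnKC // -ltnS.
have coord (i : 'I_t.+1) : exists c : {ffun 'I_h -> K},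
    u ^+ i * v ^+ (t - i) = \sum_(j < h) quot_scale (c j) (b j).
  by have [c [? _]] := b_basis _ (mon_t i); exists c.
have {coord}[c cE] := fin_all_exists coord.
pose M := \matrix_(i < t.+1, j < h) c i j.
have evalE (r : 'rV_t.+1) :
    form_eval t (rVpoly r) = \sum_(j < h) quot_scale ((r *m M) 0 j) (b j).
  rewrite /form_eval; under eq_bigr do rewrite coef_rVpoly_ord cE mulr_sumr.
  rewrite exchange_big; apply: eq_bigr => j _ /=.
  rewrite /quot_scale mxE !rmorph_sum mulr_suml; apply: eq_bigr => i _ /=.
  by rewrite mxE mpolyCM rmorphM mulrA.
have b_free (r : 'rV_h) : \sum_(j < h) quot_scale (r 0 j) (b j) = 0 -> r = 0.
  have [|d [_ d_uniq]] := b_basis 0.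
    by exists 0; rewrite ?rpred0 ?rmorph0.
  move=> r0; have d0 : d = [ffun=> 0].
    apply: d_uniq; rewrite big1 // => j _.
    by rewrite ffunE /quot_scale rmorph0 mul0r.
  have dr : d = [ffun j => r 0 j].
    by apply: d_uniq; rewrite -[LHS]r0; apply: eq_bigr => j _; rewrite ffunE.
  apply/rowP => j; rewrite mxE; have /ffunP/(_ j) := dr.
  by rewrite d0 !ffunE.
have scale0 j : quot_scale 0 (b j) = 0 by rewrite /quot_scale rmorph0 mul0r.
exists (kermx M); split=> [|r]; last first.
  rewrite evalE; split=> [/sub_kermxP->|/b_free/sub_kermxP //].
  by rewrite big1 // => j _; rewrite mxE scale0.
suff fullM : row_full M.
  by rewrite mxrank_ker (eqP fullM) subnK // -(eqP fullM) rank_leq_row.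
rewrite -sub1mx; apply/row_subP => j; rewrite row1.
have [p size_p b_j] := graded_piece_form_eval (b_t j).
apply/submxP; exists (poly_rV p); apply/eqP; rewrite -subr_eq0; apply/eqP/b_free.
have -> : \sum_(k < h) quot_scale ((delta_mx 0 j - poly_rV p *m M) 0 k) (b k) =
    b j - form_eval t p.
  rewrite -[p in RHS](poly_rV_K size_p) evalE.
  have -> : b j = \sum_(k < h) quot_scale ((delta_mx 0 j : 'rV_h) 0 k) (b k).
    rewrite (bigD1 j) //= big1 ?addr0 => [|k ne_kj]; last first.
      by rewrite mxE (negPf ne_kj) andbF scale0.
    by rewrite mxE !eqxx /quot_scale rmorph1 mul1r.
  rewrite -sumrB; apply: eq_bigr => k _; rewrite /quot_scale -mulrBl -rmorphB -mpolyCB.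
  by rewrite !mxE.
by rewrite -b_j subrr.
Qed.

(** When [h <= t] there is a nonzero relation in degree [t]. Multiplying relations by [v] and [u]
    gives relations in degree [t.+1], so the rank of the kernel grows by at least one, as does the
    number of monomials in [u] and [v]. *)
Lemma hilbert_decr (t h h' : nat) :
    hilbert_eq I t h -> hilbert_eq I t.+1 h' -> (h <= t)%N -> (h' <= h)%N.
Proof.
move=> /form_kernel[V [rkV inV]] /form_kernel[W [rkW inW]] le_ht.
suff : (\rank V < \rank W)%N by lia.
apply: mxrank_lt_mulX => [|r /inV r0]; first by rewrite -mxrank_eq0; lia.
have size_r : (size (rVpoly r) <= t.+1)%N by exact: size_poly.
split; apply/inW; rewrite poly_rV_K.
- by rewrite form_eval_widen // r0 mulr0.
- exact: leq_trans size_r _.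
- by rewrite form_eval_mulX r0 mulr0.
by rewrite (leq_trans (size_polyMleq _ _)) // size_polyX.
Qed.

End BinaryForms.

Lemma hilbert_growth (h : nat -> nat) :
    (forall t, hilbert_eq I t (h t)) -> h 1 = 2 ->
  (forall t, h t <= t.+1)%N /\ (forall t, h t <= t -> h t.+1 <= h t)%N.
Proof.
(* The two basis elements of the degree one piece serve as [u] and [v]. *)
move=> hilb h1; have := hilb 1%N; rewrite h1 => -[b [b_deg1 b_basis]].
have span x : graded_piece (I := I) 1 x ->
    exists c d : K, x = scal c * b ord0 + scal d * b ord_max.
  move=> /b_basis[c [-> _]]; exists (c ord0), (c ord_max).
  rewrite big_ord_recl big_ord1 /quot_scale.
  by congr (_ + scal (c _) * b _); apply/val_inj.
split=> t; last exact: hilbert_decr (b_deg1 _) (b_deg1 _) span _ _ _ (hilb _) (hilb _).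
have [V [rkV _]] := form_kernel (b_deg1 _) (b_deg1 _) span (hilb t).
by rewrite -rkV leq_addl.
Qed.

End Growth.

(* The bijection between strict partitions and Hilbert functions *)
Local Close Scope quotient_scope.
Local Close Scope ring_scope.

Lemma diag_vector_distinct_partitions (K : fieldType) (n : nat) :
  (diag_vector @` distinct_partitions_ge2 n)%classic = L2 K n.
Proof.
apply/seteqP; split=> [_ [s [[s_sorted s0 s_sum] s_uniq s_size] <-]|v].
  have s_gt0 i : (i < size s)%N -> (0 < nth 0%N s i)%N.
    by move=> lti; rewrite lt0n; apply: contra s0 => /eqP<-; apply: mem_nth.
  have head_gt0 : (0 < head 0%N s)%N by rewrite -nth0 s_gt0 // ltnW.
  split; rewrite ?sumn_diag_vector ?diag_vector_head //.
    exact: is_h_vector_diag_vector.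
  rewrite nth_diag_vector //; have := s_gt0 _ s_size.
  have := leq_nth_addn s_sorted s_uniq (leq0n 1) s_size.
  (* Row [1] has a cell on antidiagonal [1] since there are two parts, while row [2] starts only on
     antidiagonal [2]. *)
  by have := ltn_diag_count s_sorted s_uniq 1 1; have := ltn_diag_count s_sorted s_uniq 2 1; lia.
case=> [[m [I [_ _ [hilb v_last]]]] _ v1 v_sum].
have [h_le h_nincr] := hilbert_growth hilb v1.
exists (mkseq (fun b => count (fun x => b < x)%N v) (\max_(x <- v) x)); last first.
  exact: diag_vector_cols.
have sorted_cols := cols_sorted h_le h_nincr v_last.
split; [split|..].
- by apply: sub_sorted sorted_cols => i j /ltnW.
- exact: cols_notin0.
- by rewrite sumn_cols.
- by apply: sorted_uniq sorted_cols => [i j k /= ? ?|i]; [lia|rewrite /= ltnn].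
(* The entry [2] at index [1] makes the maximum of [v], which is the number of parts, at least
   [2]. *)
by rewrite (size_cols v1).
Qed.

Theorem theorem3p8 (K : fieldType) (n : nat) (hn : (1 <= n)%N) :
  exists N : nat,
    (distinct_partitions_ge2 n #= `I_N)%card /\ (L2 K n #= `I_N)%card.
Proof.
have /finite_setP[N cardN] := finite_distinct_partitions_ge2 n.
exists N; split=> //; apply: card_eq_trans cardN; rewrite -diag_vector_distinct_partitions.
apply: inj_card_eq => r s; rewrite !inE => -[[sr r0 _] ur _] [[ss s0 _] us _].
exact: diag_vector_inj.
Qed.
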